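(* Let $X$ be a finite set, and let $(X,S)$ be a non-degenerate symmetric set-theoretical solution of the quantum Yang-Baxter equation. Assume $H$ is a Garside subgroup of $G(X,S)$ such that its atom set $X_H$ is closed under right complement in the Garside monoid $M(X,S)$. Then there exists a uniquely well-defined bijective map $S_H:X_H\times X_H\to X_H\times X_H$ such that the pair $(X_H,S_H)$ is a non-degenerate symmetric set-theoretical solution and $G(X_H,S_H)$ is isomorphic to $H$.
   Context: Solutions. Let $X$ be a set and $S:X\times X\to X\times X$ a bijection; write $S(x,y)=(g_x(y),f_y(x))$. The pair $(X,S)$ is non-degenerate if $f_x$ and $g_x$ are bijections of $X$ for every $x\in X$; involutive if $S\circ S=\mathrm{id}_{X\times X}$; braided if $S^{12}S^{23}S^{12}=S^{23}S^{12}S^{23}$ on $X^3$, where $S^{12}=S\times \mathrm{id}_X$, $S^{23}=\mathrm{id}_X\times S$; symmetric if it is involutive and braided. A non-degenerate symmetric set-theoretical solution of the quantum Yang-Baxter equation is a pair $(X,S)$ that is non-degenerate and symmetric. Its structure group is $G(X,S)=\langle X\mid xy=g_x(y)f_y(x)\ \ (x,y\in X)\rangle$. Garside monoids. In a monoid, $x$ is a left (resp. right) divisor of $z$ if $z=xt$ (resp. $z=tx$) for some $t$. A monoid is cancellative if $xyz=xtz$ implies $y=t$. It is noetherian if every sequence $(x_n)$ in which each $x_{n+1}$ is a left divisor of $x_n$ stabilizes, and likewise for right divisors. A locally Garside monoid is a cancellative noetherian monoid in which, for each of left-divisibility and right-divisibility, any two elements have a common multiple if and only if they have a least common multiple. An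 element $\Delta$ is balanced if its sets of left and right divisors coincide; this set is then denoted $\operatorname{Div}(\Delta)$. A Garside element is a balanced element $\Delta$ such that $\operatorname{Div}(\Delta)$ generates the monoid; a Garside monoid is a locally Garside monoid having a Garside element. A Garside monoid has a unique minimal Garside element, called the Garside element. An atom is an element $x\ne 1$ such that $x=yz$ implies $y=1$ or $z=1$. For $X$ finite, the submonoid $M=M(X,S)$ of $G(X,S)$ generated by $X$ has, as a monoid, the same presentation as $G(X,S)$; it is a Garside monoid with atom set $X$ and enveloping group $G(X,S)$. Its Garside element is denoted $\Delta$. Any two elements have left and right gcds and lcms. The right lcm $x\vee y$ is the lcm for left-divisibility. The right complement of $x,y$ is the element $z$ with $xz=x\vee y$; left complements are defined dually. That $X_H$ is closed under right complement in $M(X,S)$ means that for all distinct $x,z\in X_H$ the elements $y,t\in M(X,S)$ with $xy=zt=x\vee z$ belong to $X_H$. Garside subgroups. A submonoid $N$ of $M$ is a Garside submonoid if it is generated by a non-empty subset $D\subseteq\operatorname{Div}(\Delta)$ which is a sublattice of $\operatorname{Div}(\Delta)$ for left and for right divisibility, is closed under left and right complements, and is such that for all $x,y\in D$ the left gcd and the right gcd of $xy$ and $\Delta$ in $M$ belong to $D$. A Garside subgroup $H$ of $G(X,S)$ is a subgroup generated by a Garside submonoid $N$ of $M$; its atom set $X_H$ is the set of atoms of $N$.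
   Formalization: Uniqueness of S_H is among solutions for which the inclusion of X_H in H extends to an isomorphism from G(X_H,S_H) onto H; for a merely abstract isomorphism uniqueness fails (relabel a permutation solution on 3 points). *)

(* Defs.v *)
From HB Require Import structures.
From mathcomp Require Import all_boot.
From mathcomp Require Import boolp classical_sets.

Set Implicit Arguments.
Unset Strict Implicit.
Unset Printing Implicit Defensive.

Import Algebra.

Local Open Scope group_scope.
Local Open Scope classical_set_scope.
Local Open Scope quotient_scope.

Section Solutions.
Context {X : Type}.
Implicit Types S : X * X -> X * X.

(* S (x, y) = (g_x y, f_y x): in sol_f the first argument is the index y. *)
Definition sol_g S (x y : X) : X := (S (x, y)).1.
Definition sol_f S (y x : X) : X := (S (x, y)).2.

Definition nondegenerate S : Prop :=
  forall x, bijective (sol_f S x) /\ bijective (sol_g S x).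

Definition S12 S (t : X * X * X) : X * X * X :=
  let: (x, y, z) := t in let: (x', y') := S (x, y) in (x', y', z).
Definition S23 S (t : X * X * X) : X * X * X :=
  let: (x, y, z) := t in let: (y', z') := S (y, z) in (x, y', z').

Definition braided S : Prop :=
  S12 S \o S23 S \o S12 S =1 S23 S \o S12 S \o S23 S.

Definition symmetric_solution S : Prop := involutive S /\ braided S.

Definition nondegenerate_symmetric_solution S : Prop :=
  [/\ bijective S, nondegenerate S & symmetric_solution S].

End Solutions.

Section StructureGroup.
Context {X : choiceType}.
Variable S : X * X -> X * X.

(* Group words: (false, x) stands for x and (true, x) for x^-1. *)
Definition gword : Type := seq (bool * X).

Definition letter (x : X) : bool * X := (false, x).

Inductive sg_rel : gword -> gword -> Prop :=
| SgRefl u : sg_rel u u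
| SgSym u v : sg_rel u v -> sg_rel v u
| SgTrans u v w : sg_rel u v -> sg_rel v w -> sg_rel u w
| SgCat u u' v v' : sg_rel u u' -> sg_rel v v' -> sg_rel (u ++ v) (u' ++ v')
| SgCancel b x : sg_rel [:: (b, x); (~~ b, x)] [::]
| SgSol x y :
    sg_rel [:: letter x; letter y] [:: letter (sol_g S x y); letter (sol_f S y x)].

Definition sg_eqv (u v : gword) : bool := `[< sg_rel u v >].

Fact sg_eqv_refl : reflexive sg_eqv.
Proof. by move=> u; apply/asboolP; exact: SgRefl. Qed.

Fact sg_eqv_sym : symmetric sg_eqv.
Proof. by move=> u v; apply/asboolP/asboolP; exact: SgSym. Qed.

Fact sg_eqv_trans : transitive sg_eqv.
Proof.
by move=> v u w /asboolP uv /asboolP vw; apply/asboolP; exact: SgTrans uv vw.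
Qed.

Canonical sg_equiv := EquivRel sg_eqv sg_eqv_refl sg_eqv_sym sg_eqv_trans.

Definition structure_group : Type := {eq_quot sg_equiv}.
HB.instance Definition _ := Choice.on structure_group.
HB.instance Definition _ := EqQuotient.on structure_group.

Definition sg_class (u : gword) : structure_group := \pi_structure_group u.

Lemma sg_classP u v : sg_class u = sg_class v <-> sg_rel u v.
Proof.
split; first by move=> /eqmodP /asboolP.
by move=> uv; apply/eqmodP/asboolP.
Qed.

Lemma sg_classK (a : structure_group) : sg_class (repr a) = a.
Proof. exact: reprK. Qed.

Definition gword_inv (u : gword) : gword := rev [seq (~~ p.1, p.2) | p <- u].

Lemma gword_invK : involutive gword_inv.
Proof.
move=> u; rewrite /gword_inv map_rev revK -map_comp -[RHS]map_id.
by apply: eq_map => -[b x] /=; rewrite negbK.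
Qed.

Lemma sg_rel_catV u : sg_rel (u ++ gword_inv u) [::].
Proof.
elim: u => [|[b x] u IHu]; first exact: SgRefl.
have -> : ((b, x) :: u) ++ gword_inv ((b, x) :: u) =
    [:: (b, x)] ++ (u ++ gword_inv u) ++ [:: (~~ b, x)].
  by rewrite /gword_inv /= rev_cons -cats1 !catA.
apply: SgTrans (SgCancel b x); rewrite -[X in sg_rel _ X]/([:: (b, x)] ++ [::] ++ [:: (~~ b, x)]).
apply: SgCat; first exact: SgRefl.
by apply: SgCat IHu _; exact: SgRefl.
Qed.

Lemma sg_rel_inv u v : sg_rel u v -> sg_rel (gword_inv u) (gword_inv v).
Proof.
move=> uv.
have h1 : sg_rel (gword_inv u) (gword_inv u ++ (v ++ gword_inv v)).
  rewrite -[X in sg_rel X]cats0; apply: SgCat; first exact: SgRefl.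
  by apply: SgSym; exact: sg_rel_catV.
apply: SgTrans h1 _; rewrite catA -[X in sg_rel _ X]cat0s.
apply: SgCat; last exact: SgRefl.
apply: SgTrans (SgCat (SgRefl _) (SgSym uv)) _.
by rewrite -{2}[u]gword_invK; exact: sg_rel_catV.
Qed.

Definition sg_one : structure_group := sg_class [::].
Definition sg_mul (a b : structure_group) : structure_group :=
  sg_class (repr a ++ repr b).
Definition sg_inv (a : structure_group) : structure_group :=
  sg_class (gword_inv (repr a)).

Lemma sg_repr u : sg_rel (repr (sg_class u)) u.
Proof. by apply/sg_classP; exact: sg_classK. Qed.

Lemma sg_mulE u v : sg_mul (sg_class u) (sg_class v) = sg_class (u ++ v).
Proof. by apply/sg_classP; apply: SgCat; exact: sg_repr. Qed.

Lemma sg_invE u : sg_inv (sg_class u) = sg_class (gword_inv u).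
Proof. by apply/sg_classP; apply: sg_rel_inv; exact: sg_repr. Qed.

Fact sg_mulA : associative sg_mul.
Proof.
move=> a b c; rewrite -(sg_classK a) -(sg_classK b) -(sg_classK c).
by rewrite !sg_mulE catA.
Qed.

Fact sg_mul1 : left_id sg_one sg_mul.
Proof. by move=> a; rewrite -(sg_classK a) sg_mulE. Qed.

Fact sg_mulr1 : right_id sg_one sg_mul.
Proof. by move=> a; rewrite -(sg_classK a) sg_mulE cats0. Qed.

Fact sg_mulrV : right_inverse sg_one sg_inv sg_mul.
Proof.
move=> a; rewrite -(sg_classK a) sg_invE sg_mulE.
by apply/sg_classP; exact: sg_rel_catV.
Qed.

Fact sg_mulVr : left_inverse sg_one sg_inv sg_mul.
Proof.
move=> a; rewrite -(sg_classK a) sg_invE sg_mulE.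
by apply/sg_classP; rewrite -{2}[repr a]gword_invK; exact: sg_rel_catV.
Qed.

HB.instance Definition _ :=
  isGroup.Build structure_group sg_mulA sg_mul1 sg_mulr1 sg_mulVr sg_mulrV.

Definition sg_gen (x : X) : structure_group := sg_class [:: letter x].

End StructureGroup.

Section Garside.
Context {G : groupType}.
Implicit Types A D H M N : set G.

Definition submonoid_generated A : set G :=
  smallest (fun B : set G => monoid_closed (mem B)) A.
Definition subgroup_generated A : set G :=
  smallest (fun B : set G => group_closed (mem B)) A.

(* A monoid is represented as a submonoid M of an ambient group G; its
   divisibility relations have both arguments and the cofactor in M. *)
Definition ldiv M (x z : G) : Prop := M x /\ exists2 t, M t & z = x * t.
Definition rdiv M (x z : G) : Prop := M x /\ exists2 t, M t & z = t * x.

Definition is_lcm (dv : G -> G -> Prop) (x y m : G) : Prop :=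
  [/\ dv x m, dv y m & forall z, dv x z -> dv y z -> dv m z].
Definition is_gcd (dv : G -> G -> Prop) (x y d : G) : Prop :=
  [/\ dv d x, dv d y & forall z, dv z x -> dv z y -> dv z d].

Definition atoms M : set G :=
  [set x | [/\ M x, x <> 1 &
     forall y z, M y -> M z -> x = y * z -> y = 1 \/ z = 1]].

Definition balanced M (d : G) : Prop := forall x, ldiv M x d <-> rdiv M x d.

Definition Div M (d : G) : set G := [set x | ldiv M x d].

Definition garside_element M (d : G) : Prop :=
  [/\ M d, balanced M d & submonoid_generated (Div M d) = M].

Definition minimal_garside_element M (d : G) : Prop :=
  garside_element M d /\
  forall d', garside_element M d' -> ldiv M d' d -> d' = d.

Definition sublattice (dv : G -> G -> Prop) D : Prop :=
  forall x y, D x -> D y ->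
    (exists2 m, is_lcm dv x y m & D m) /\ (exists2 d, is_gcd dv x y d & D d).

(* The right complement is taken with respect to the lcm for left
   divisibility, the left complement to the lcm for right divisibility. *)
Definition is_right_complement M (x y z : G) : Prop :=
  M z /\ is_lcm (ldiv M) x y (x * z).
Definition is_left_complement M (x y z : G) : Prop :=
  M z /\ is_lcm (rdiv M) x y (z * x).

Record garside_generating M (Delta : G) D : Prop := {
  gg_nonempty : D !=set0;
  gg_simple : D `<=` Div M Delta;
  gg_lsublattice : sublattice (ldiv M) D;
  gg_rsublattice : sublattice (rdiv M) D;
  gg_rcomplement : forall x y z,
    D x -> D y -> is_right_complement M x y z -> D z;
  gg_lcomplement : forall x y z,
    D x -> D y -> is_left_complement M x y z -> D z;
  gg_gcd : forall x y, D x -> D y ->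
    (exists2 d, is_gcd (ldiv M) (x * y) Delta d & D d) /\
    (exists2 d, is_gcd (rdiv M) (x * y) Delta d & D d)
}.

Definition garside_submonoid M (Delta : G) N : Prop :=
  exists2 D, garside_generating M Delta D & N = submonoid_generated D.

Definition closed_under_right_complement M A : Prop :=
  forall x z, A x -> A z -> x <> z ->
  forall y t, M y -> M t -> x * y = z * t -> is_lcm (ldiv M) x z (x * y) ->
    A y /\ A t.

End Garside.

Definition structure_monoid {X : choiceType} (S : X * X -> X * X) :
  set (structure_group S) := submonoid_generated (range (sg_gen S)).
Arguments structure_monoid {X} S.

(* H is a Garside subgroup of G(X, S), N being a Garside submonoid of M(X, S)
   that generates it. *)
Definition garside_subgroup {X : choiceType} (S : X * X -> X * X)
    (N H : set (structure_group S)) : Prop :=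
  exists2 Delta, minimal_garside_element (structure_monoid S) Delta &
    garside_submonoid (structure_monoid S) Delta N /\ H = subgroup_generated N.
Arguments garside_subgroup {X} S N H.

(* An isomorphism from G(A, T) onto the subgroup H that extends the inclusion
   of A in H. An abstract isomorphism would only see T up to relabelling A. *)
Definition structure_group_iso {G : groupType} (A : set G)
    (T : A * A -> A * A) (H : set G)
    (phi : {multiplicative structure_group T -> G}) : Prop :=
  [/\ injective phi, range phi = H & forall a : A, phi (sg_gen T a) = val a].
Arguments structure_group_iso {G A} T H phi.

(* Main.v *)
(* The structure group of (X, S) acts on Z^X by affine maps, the generator x
   sending v to e_x + g_x(v). The orbit map of 0 identifies M(X, S), ordered by
   left divisibility, with N^X, so that in M an element below x \/ z and disjoint
   from x and from z is trivial. Distinct atoms of N have trivial gcd, hence for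
   fixed x the right complement z |-> x \ z is injective on X_H \ {x} and misses
   exactly one atom, which one takes as x \ x. The identity
   (x \ y) \ (x \ z) = (y \ x) \ (y \ z) says, for distinct x, y, z, that both
   sides complete x \/ y to x \/ y \/ z; the remaining cases follow by counting.
   The map (x, x \ z) |-> (z, z \ x) is then the required solution, it is forced
   by the relations holding in H, and word reversing shows that equality of
   positive words, hence of fractions, is detected in H. *)

Require Import Defs.
From HB Require Import structures.
From mathcomp Require Import all_boot.
From mathcomp Require Import order ssralg ssrnum ssrint zify.
From mathcomp Require Import boolp classical_sets.

Set Implicit Arguments.
Unset Strict Implicit.
Unset Printing Implicit Defensive.

Import Order.TTheory GRing.Theory Num.Theory.
Local Open Scope group_scope.

(** * Elementary facts on generated submonoids *)

Section SubmonoidGenerated.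
Context {G : groupType}.

Lemma submonoid_generated1 (D : set G) : submonoid_generated D 1.
Proof. by move=> B [[+ _] _]; rewrite in_setE. Qed.

Lemma submonoid_generatedM (D : set G) a b : submonoid_generated D a ->
  submonoid_generated D b -> submonoid_generated D (a * b).
Proof.
move=> Da Db B Bcl; have [[_ BM] _] := Bcl.
suff: a * b \in mem B by rewrite in_setE.
by apply: BM; rewrite in_setE; [apply: Da | apply: Db].
Qed.

Lemma submonoid_generated_ind (D : set G) (P : G -> Prop) : P 1 ->
  (forall a b, P a -> P b -> P (a * b)) -> (forall a, D a -> P a) ->
  forall a, submonoid_generated D a -> P a.
Proof.
move=> P1 PM DP; apply: (@smallest_sub _ _ _ [set a | P a]) => //.
by split; [rewrite in_setE | move=> a b; rewrite !in_setE; apply: PM].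
Qed.

End SubmonoidGenerated.

(** * Positive words and the universal property of the structure group *)

Section PositiveWords.
Context {X : choiceType} (S : X * X -> X * X).

Definition pos_word (w : seq X) : gword := [seq letter x | x <- w].

Definition pos_class (w : seq X) : structure_group S := sg_class S (pos_word w).

Lemma pos_class_nil : pos_class [::] = 1.
Proof. by []. Qed.

Lemma pos_class_cat u w : pos_class (u ++ w) = pos_class u * pos_class w.
Proof. by rewrite /pos_class /pos_word map_cat -sg_mulE. Qed.

Lemma pos_class_cons x w : pos_class (x :: w) = sg_gen S x * pos_class w.
Proof. exact: (pos_class_cat [:: x]). Qed.

Lemma sg_class_cons b x u :
  sg_class S ((b, x) :: u) = (if b then (sg_gen S x)^-1 else sg_gen S x) * sg_class S u.
Proof.
rewrite -cat1s -sg_mulE; congr (_ * _); case: b => //.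
by rewrite /sg_gen -[RHS]/(sg_inv _) sg_invE.
Qed.

Lemma sg_gen_sol x y :
  sg_gen S x * sg_gen S y = sg_gen S (sol_g S x y) * sg_gen S (sol_f S y x).
Proof. by rewrite -![_ * _]/(sg_mul _ _) !sg_mulE; apply/sg_classP/SgSol. Qed.

Lemma structure_group_ind (P : structure_group S -> Prop) : P 1 ->
  (forall x a, P a -> P (sg_gen S x * a)) ->
  (forall x a, P a -> P ((sg_gen S x)^-1 * a)) -> forall a, P a.
Proof.
move=> P1 Pgen PgenV a; rewrite -(sg_classK a).
elim: (repr a) => [|[b x] u IHu] //.
by rewrite sg_class_cons; case: b; [apply: PgenV | apply: Pgen].
Qed.

(** Evaluating a signed word in [G] respects every constructor of [sg_rel], so the value does not
    depend on the chosen representative of a class. *)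
Lemma structure_group_lift (G : groupType) (h : X -> G) :
  (forall x y, h x * h y = h (sol_g S x y) * h (sol_f S y x)) ->
  exists phi : {multiplicative structure_group S -> G},
    forall x, phi (sg_gen S x) = h x.
Proof.
move=> h_sol; pose hw (u : gword) : G :=
  \prod_(p <- u) (if p.1 then (h p.2)^-1 else h p.2).
have hw_rel u v : sg_rel S u v -> hw u = hw v.
  elim=> {u v} // [u v w _ -> _ -> //|u u' v v' _ IHu _ IHv|b x|x y].
  - by rewrite /hw !big_cat /= -!/(hw _) IHu IHv.
  - by rewrite /hw !big_cons big_nil /= mulg1; case: b; rewrite /= ?mulVg ?mulgV.
  - by rewrite /hw !big_cons !big_nil /= !mulg1 h_sol.
pose phi (a : structure_group S) := hw (repr a).
have phiE u : phi (sg_class S u) = hw u by apply/hw_rel/sg_repr.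
have phiM : {morph phi : a b / a * b}.
  move=> a b; rewrite -(sg_classK a) -(sg_classK b).
  by rewrite -[X in phi X]/(sg_mul _ _) sg_mulE !phiE /hw big_cat.
pose Phi : {multiplicative structure_group S -> G} :=
  HB.pack phi (isMultiplicative.Build _ _ phi phiM).
by exists Phi => x; rewrite /= phiE /hw big_seq1.
Qed.

End PositiveWords.

(** * The affine action of the structure group *)

Section IStructure.
Context {X : finType} (S : X * X -> X * X).
Hypothesis S_sol : nondegenerate_symmetric_solution S.

Local Notation g := (sol_g S).
Local Notation f := (sol_f S).

Lemma sol_g_inj x : injective (g x).
Proof. by case: S_sol => _ nd _; case: (nd x) => _ /bij_inj. Qed.

Local Notation g' x := (invF (@sol_g_inj x)).

Lemma sol_g_sol_f x y : g (g x y) (f y x) = x.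
Proof.
case: S_sol => _ _ [invo _]; have := invo (x, y).
by rewrite /sol_g /sol_f -surjective_pairing => ->.
Qed.

(** First coordinate of the braid relation: it makes [x |-> g x] an action of the structure group on
    [X]. *)
Lemma sol_g_action x y z : g x (g y z) = g (g x y) (g (f y x) z).
Proof.
case: S_sol => _ _ [_ br]; have := br (x, y, z).
rewrite /= /S12 /S23 /sol_g /sol_f /=.
case: (S (x, y)) => a b /=; case: (S (b, z)) => c d /=.
case: (S (a, c)) => e1 e2 /=; case: (S (y, z)) => p q /=.
by case: (S (x, p)) => r s /=; case: (S (s, q)) => t u /= [-> _ _].
Qed.

(* The structure group acts on Z^X by affine maps, a generator x sending v to
   e_x + g_x(v). *)
Definition aff (x : X) (v : X -> int) : X -> int :=
  fun c => ((c == x)%:Z + v (g' x c))%R.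
Definition aff_inv (x : X) (v : X -> int) : X -> int :=
  fun c => (v (g x c) - (g x c == x)%:Z)%R.

Lemma affK x : cancel (aff x) (aff_inv x).
Proof. by move=> v; apply/funext => c; rewrite /aff_inv /aff invF_f; lia. Qed.

Lemma aff_invK x : cancel (aff_inv x) (aff x).
Proof. by move=> v; apply/funext => c; rewrite /aff_inv /aff f_invF; lia. Qed.

Lemma aff_g x v c : aff x v (g x c) = ((g x c == x)%:Z + v c)%R.
Proof. by rewrite /aff invF_f. Qed.

(** Both composites have the same linear part, and their translation parts are e_x and e_{g_x(y)}
    added in opposite orders. *)
Lemma aff_sol x y v : aff x (aff y v) = aff (g x y) (aff (f y x) v).
Proof.
apply/funext => c; pose b := g' y (g' x c).
have -> : c = g x (g y b) by rewrite /b !f_invF.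
rewrite !aff_g sol_g_action !aff_g -sol_g_action.
have -> : (g x (g y b) == x) = (g (f y x) b == f y x).
  by rewrite sol_g_action -[X in _ == X](sol_g_sol_f x y) !(inj_eq (@sol_g_inj _)).
rewrite (inj_eq (@sol_g_inj _)); lia.
Qed.

Definition word_aff (u : gword) : (X -> int) -> X -> int :=
  foldr (fun p F => (if p.1 then aff_inv p.2 else aff p.2) \o F) id u.

Lemma word_aff_cat u w v : word_aff (u ++ w) v = word_aff u (word_aff w v).
Proof. by elim: u => //= p u ->. Qed.

Lemma word_aff_rel u u' : sg_rel S u u' -> word_aff u = word_aff u'.
Proof.
elim=> {u u'} // [u v w _ -> _ -> //|u u' v v' _ IHu _ IHv|[] x|x y];
  apply/funext => a.
- by rewrite !word_aff_cat IHu IHv.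
- by rewrite /= affK.
- by rewrite /= aff_invK.
- by rewrite /= aff_sol.
Qed.

(** The orbit map of 0, which gives the coordinates of a positive word in N^X. *)
Definition wt (w : seq X) : X -> int := word_aff (pos_word w) (fun=> 0%R).

Lemma wt_cons x w : wt (x :: w) = aff x (wt w).
Proof. by []. Qed.

Lemma wt1 x c : wt [:: x] c = ((c == x)%:Z)%R.
Proof. exact: addr0. Qed.

Lemma wt_ge0 w c : (0 <= wt w c)%R.
Proof.
by elim: w c => [|x w IHw] c //; rewrite wt_cons /aff; have := IHw (g' x c); lia.
Qed.

(** The linear part of the action of [u] permutes coordinates and its translation part is [wt u];
    extending a word on the right therefore never lowers its weight. *)
Lemma wt_cat_perm u : exists2 s : X -> X, injective s &
  forall w c, wt (u ++ w) c = (wt u c + wt w (s c))%R.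
Proof.
elim: u => [|x u [s s_inj IHs]].
  by exists id => // w c; rewrite /wt /=; lia.
exists (s \o g' x); first by apply: inj_comp (can_inj (f_invF (@sol_g_inj x))).
by move=> w c; rewrite !wt_cons /aff IHs /=; lia.
Qed.

Lemma sum_wt w : (\sum_c wt w c)%R = ((size w)%:Z)%R.
Proof.
elim: w => [|x w IHw]; first by rewrite big1.
rewrite wt_cons /aff big_split /=.
rewrite -(reindex_inj (can_inj (f_invF (@sol_g_inj x))) (P := xpredT) (F := wt w)).
rewrite IHw (bigD1 x) //= eqxx big1 => [|c /negPf->] //; lia.
Qed.

Lemma size_le_sum u (v : X -> int) :
  (forall c, wt u c <= v c)%R -> ((size u)%:Z <= \sum_c v c)%R.
Proof. by move=> le_v; rewrite -sum_wt ler_sum. Qed.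

(** Wherever [wt u c] is below [v c], appending the letter [s c] adds exactly the unit vector at
    [c]. The induction is on the total defect. *)
Lemma wt_extend u (v : X -> int) :
  (forall c, wt u c <= v c)%R -> exists w, wt (u ++ w) = v.
Proof.
set k : int := (\sum_c v c)%R; have [n] := ubnP (absz (k - (size u)%:Z)%R).
elim: n u => // n IHn u le_n le_v.
have [eq_v|] := pselect (forall c, wt u c = v c).
  by exists [::]; rewrite cats0; apply/funext.
move=> /existsNP[c ne_c].
have [s s_inj wt_u] := wt_cat_perm u.
have le_v' d : (wt (u ++ [:: s c]) d <= v d)%R.
  rewrite wt_u wt1 (inj_eq s_inj).
  have := le_v d; case: eqP => [->|_]; have := le_v c; lia.
have := size_le_sum le_v'; rewrite size_cat /= -/k => le_size.
have [||w wE] := IHn (u ++ [:: s c]) => //.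
  by rewrite size_cat /=; lia.
by exists (s c :: w); rewrite -wE -catA.
Qed.

(* If the words start with distinct letters x and z, then e_x + e_z lies below
   their common weight, so both can be rewritten to start with the two sides of
   the defining relation x y = z t. *)
Lemma wt_inj u v : wt u = wt v -> sg_rel S (pos_word u) (pos_word v).
Proof.
have [n] := ubnP (size u); elim: n u v => // n IHn [|x u] [|z v] /= le_n wt_uv.
- exact: SgRefl.
- by have := sum_wt (z :: v); rewrite -wt_uv sum_wt.
- by have := sum_wt (x :: u); rewrite wt_uv sum_wt.
rewrite -[letter x :: _]cat1s -[letter z :: _]cat1s.
have [eq_xz|ne_xz] := eqVneq x z.
  subst z; apply: SgCat (SgRefl _ _) _; apply: IHn => //.
  by apply: (can_inj (affK x)).
pose y := g' x z; have yE : g x y = z by rewrite f_invF.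
have [|w wE] := @wt_extend [:: y] (wt u).
  move=> c; rewrite wt1.
  have := congr1 (fun F => F z) wt_uv.
  rewrite !wt_cons /aff eqxx [z == x]eq_sym (negPf ne_xz).
  have := wt_ge0 u c; have := wt_ge0 v (g' z z).
  case: eqP => [->|_]; last by lia.
  by rewrite -/y; lia.
pose t := f y x.
have wE' : wt (t :: w) = wt v.
  apply: (can_inj (affK z)); rewrite -[RHS]wt_cons -wt_uv [RHS]wt_cons -wE.
  by rewrite !wt_cons -yE -aff_sol.
have size_u : size u = (size w).+1.
  by have := sum_wt u; rewrite -wE sum_wt => -[].
have u_w : sg_rel S (pos_word u) (pos_word (y :: w)) by apply: IHn.
have v_w : sg_rel S (pos_word (t :: w)) (pos_word v).
  by apply: IHn => //; rewrite /= -size_u.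
apply: SgTrans (SgCat (SgRefl _ _) u_w) _.
apply: SgTrans (SgCat (SgRefl _ [:: letter z]) v_w).
have := SgCat (SgSol S x y) (SgRefl S (pos_word w)).
by rewrite yE.
Qed.

(** * Left divisibility and length in [M(X, S)] *)

Lemma structure_monoidE : structure_monoid S = range (pos_class S).
Proof.
apply/seteqP; split.
  apply: smallest_sub => [|_ [x _ <-]]; last by exists [:: x].
  split; first by rewrite in_setE; exists [::].
  move=> a b; rewrite !in_setE => -[u _ <-] [v _ <-]; exists (u ++ v) => //.
  by rewrite pos_class_cat.
move=> _ [w _ <-] B [[B1 BM] BX]; elim: w => [|x w IHw].
  by move: B1; rewrite in_setE.
rewrite -cat1s pos_class_cat.
suff: pos_class S [:: x] * pos_class S w \in mem B by rewrite in_setE.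
by apply: BM; rewrite in_setE //; apply: BX; exists x.
Qed.

Lemma pos_class_wt u v : pos_class S u = pos_class S v -> wt u = wt v.
Proof. by move=> /sg_classP /word_aff_rel; rewrite /wt => ->. Qed.

Lemma wt_class u v : wt u = wt v -> pos_class S u = pos_class S v.
Proof. by move=> /wt_inj /sg_classP. Qed.

(** [wt_extend] supplies the cofactor as a word, and [wt_inj] turns equality of weights into
    equality in the group. *)
Lemma ldiv_wtP u v : ldiv (structure_monoid S) (pos_class S u) (pos_class S v) <->
  forall c, (wt u c <= wt v c)%R.
Proof.
rewrite /ldiv structure_monoidE; split.
  move=> [_ [_ [w _ <-]]]; rewrite -pos_class_cat => /pos_class_wt -> c.
  by have [s _ ->] := wt_cat_perm u; have := wt_ge0 w (s c); lia.
move=> /wt_extend[w /wt_class uw_v]; split; first by exists u.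
by exists (pos_class S w); [exists w | rewrite -pos_class_cat].
Qed.

Lemma wt_nil c : wt [::] c = 0%R.
Proof. by []. Qed.

Lemma pos_class_eq1 u : pos_class S u = 1 -> u = [::].
Proof.
move=> /(@pos_class_wt u [::]) wt_u; apply/nilP; rewrite /nilp.
by have := sum_wt u; rewrite wt_u (sum_wt [::]) => -[<-].
Qed.

Lemma structure_monoid_unit_free a b : structure_monoid S a ->
  structure_monoid S b -> a * b = 1 -> a = 1.
Proof.
rewrite structure_monoidE => -[u _ <-] [v _ <-]; rewrite -pos_class_cat.
by move/pos_class_eq1; case: u.
Qed.

(** If both weights were positive at [c], the letter [c] would be a common left divisor. *)
Lemma is_gcd1_wt u v :
  is_gcd (ldiv (structure_monoid S)) (pos_class S u) (pos_class S v) 1 ->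
  forall c, wt u c = 0%R \/ wt v c = 0%R.
Proof.
move=> [_ _ gcd1] c.
have [wt_u|/eqP u0] := eqVneq (wt u c) 0%R; first by left.
have [wt_v|/eqP v0] := eqVneq (wt v c) 0%R; first by right.
have le_c w : wt w c <> 0%R ->
    ldiv (structure_monoid S) (pos_class S [:: c]) (pos_class S w).
  move=> w0; apply/ldiv_wtP => d; rewrite wt1; case: eqP => [->|_].
    by have := wt_ge0 w c; lia.
  exact: wt_ge0.
have /(ldiv_wtP [:: c] [::])/(_ c) := gcd1 _ (le_c _ u0) (le_c _ v0).
by rewrite wt1 wt_nil eqxx.
Qed.

(* The left divisibility order is that of N^X: an element below a join but
   disjoint from both of its terms is trivial. *)
Lemma disjoint_ldiv_lcm x z z' m : structure_monoid S x -> structure_monoid S z ->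
    structure_monoid S z' ->
  is_gcd (ldiv (structure_monoid S)) x z' 1 ->
  is_gcd (ldiv (structure_monoid S)) z z' 1 ->
  is_lcm (ldiv (structure_monoid S)) x z m -> ldiv (structure_monoid S) z' m ->
  z' = 1.
Proof.
rewrite {1 2 3}structure_monoidE => -[u _ <-] [v _ <-] [w _ <-].
move=> /is_gcd1_wt uw /is_gcd1_wt vw [xm zm m_min] z'm.
(* Any common multiple bounds [m]; the one of weight [wt u + wt v] is convenient, since that weight
   vanishes wherever [w] is nonzero. *)
have [|t tE] := @wt_extend [::] (fun c => wt u c + wt v c)%R.
  by move=> c; rewrite wt_nil; have := wt_ge0 u c; have := wt_ge0 v c; lia.
have ut : ldiv (structure_monoid S) (pos_class S u) (pos_class S t).
  by apply/ldiv_wtP => c; rewrite tE; have := wt_ge0 v c; lia.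
have vt : ldiv (structure_monoid S) (pos_class S v) (pos_class S t).
  by apply/ldiv_wtP => c; rewrite tE; have := wt_ge0 u c; lia.
have mt := m_min _ ut vt; have [Mm _] := mt.
have wt_wt : forall c, (wt w c <= wt t c)%R.
  move: Mm z'm mt; rewrite {1}structure_monoidE => -[y _ <-].
  move=> /ldiv_wtP wy /ldiv_wtP yt c.
  by have := wy c; have := yt c; lia.
apply: (@wt_class w [::]); apply/funext => c; rewrite wt_nil.
have := wt_wt c; have := wt_ge0 w c; rewrite tE.
by case: (uw c) => //; case: (vw c) => // -> ->; lia.
Qed.

(** The absolute value of the exponent sum, defined on the whole group but meant for positive
    elements, where it is the word length. *)
Definition pos_length (a : structure_group S) : nat :=
  absz (\sum_c word_aff (repr a) (fun=> 0) c)%R.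

Lemma pos_lengthE w : pos_length (pos_class S w) = size w.
Proof. by rewrite /pos_length (word_aff_rel (sg_repr _ _)) (sum_wt w). Qed.

Lemma pos_lengthM a b : structure_monoid S a -> structure_monoid S b ->
  pos_length (a * b) = (pos_length a + pos_length b)%N.
Proof.
rewrite structure_monoidE => -[u _ <-] [v _ <-].
by rewrite -pos_class_cat !pos_lengthE size_cat.
Qed.

Lemma pos_length_eq0 a : structure_monoid S a -> pos_length a = 0 -> a = 1.
Proof.
by rewrite structure_monoidE => -[u _ <-]; rewrite pos_lengthE => /size0nil ->.
Qed.

(** Length is additive, so a divisor is the class of a word no longer than one for [m]. *)
Lemma structure_monoid_finite m : structure_monoid S m ->
  exists s : seq (structure_group S),
    forall a, ldiv (structure_monoid S) a m -> a \in s.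
Proof.
rewrite {1}structure_monoidE => -[w _ <-].
exists [seq pos_class S (bseqval u) | u : (size w).-bseq X] => a [].
rewrite {1}structure_monoidE => -[u _ <-] [t]; rewrite structure_monoidE => -[v _ <-].
rewrite -pos_class_cat => /(congr1 pos_length); rewrite !pos_lengthE size_cat => wE.
have le_u : (size u <= size w)%N by rewrite wE leq_addr.
by apply/mapP; exists (Bseq le_u); rewrite ?mem_enum.
Qed.

End IStructure.

(** * Cycle sets from complements *)

Section FinitelyListed.
Context {T : eqType} (s : seq T).
Hypothesis mem_s : forall x, x \in s.

Lemma listed_inj_surj (h : T -> T) : injective h -> forall y, exists x, h x = y.
Proof.
move=> h_inj y; have mem_s' x : x \in undup s by rewrite mem_undup.
have [||_ eq_s] := @uniq_min_size _ (map h (undup s)) (undup s) _ (fun x _ => mem_s' x).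
- by rewrite map_inj_uniq ?undup_uniq.
- by rewrite size_map.
by have := mem_s' y; rewrite -eq_s => /mapP[x _ ->]; exists x.
Qed.

Lemma listed_surj_inj (h : T -> T) : (forall y, exists x, h x = y) -> injective h.
Proof.
move=> /choice[k kK].
have [|l lK] := @choice _ _ (fun y x => k x = y).
  by apply: listed_inj_surj => x y /(congr1 h); rewrite !kK.
by apply: (can_inj (g := k)) => x; rewrite -{1}(lK x) kK.
Qed.

Lemma listed_inj_bij (h : T -> T) : injective h -> bijective h.
Proof.
move=> h_inj; have [k kK] := choice (listed_inj_surj h_inj).
by exists k => // x; apply: h_inj.
Qed.

(** If every value were hit away from [x], choosing preimages would inject [T] into [T] minus
    [x]. *)
Lemma listed_missed (h : T -> T) x :
  (forall y z, y <> x -> z <> x -> h y = h z -> y = z) ->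
  exists d, forall z, z <> x -> h z <> d.
Proof.
move=> h_inj; apply: contrapT => /forallNP h_surj.
have hit d : exists2 z, z <> x & h z = d.
  apply: contrapT => no_z; apply: (h_surj d) => z zx hz; apply: no_z.
  by exists z.
have [k kP] := choice (fun d => let: ex_intro2 z zx hz := hit d in
  ex_intro (fun z => z <> x /\ h z = d) z (conj zx hz)).
have [|d kd] := @listed_inj_surj k _ x.
  by move=> d e /(congr1 h); rewrite (kP d).2 (kP e).2.
by have := (kP d).1.
Qed.

End FinitelyListed.

Section Complement.
Context {T : eqType} (s : seq T).
Hypothesis mem_s : forall x, x \in s.
Variable c : T -> T -> T.
Hypothesis c_inj : forall x z z', z <> x -> z' <> x -> c x z = c x z' -> z = z'.
Hypothesis c_neq : forall x z, x <> z -> c x z <> c z x.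
Hypothesis c_inj2 : forall x z x' z', x <> z -> x' <> z' ->
  c x z = c x' z' -> c z x = c z' x' -> x = x'.
Hypothesis c_cycle : forall x y z, x <> y -> x <> z -> y <> z ->
  c (c x y) (c x z) = c (c y x) (c y z).

(* A complement is only defined off the diagonal; on it the value is forced to
   be the unique one missed by the row. *)
Lemma complement_extend : exists2 star : T -> T -> T,
  forall x z, x <> z -> star x z = c x z &
  [/\ forall x, injective (star x),
   forall x z x' z', star x z = star x' z' -> star z x = star z' x' -> x = x' &
   forall x y z, star (star x y) (star x z) = star (star y x) (star y z)].
Proof.
have [d dP] := choice (fun x => listed_missed mem_s (@c_inj x)).
pose star x z := if x == z then d x else c x z.
have starE x z : x <> z -> star x z = c x z by rewrite /star => /eqP/negPf->.
have stard x : star x x = d x by rewrite /star eqxx.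
have star_inj x : injective (star x).
  move=> y z; have [<-|/eqP xy] := eqVneq x y; have [<-|/eqP xz] := eqVneq x z => //.
  - by rewrite stard starE // => /esym/dP; case=> /esym.
  - by rewrite stard starE // => /dP; case=> /esym.
  - by rewrite !starE // => /c_inj; apply => /esym.
(* If y is hit off the diagonal in every row, each x is part of a pair x, k x
   with c x (k x) = y, and x |-> c (k x) x would inject T into T minus y. *)
have d_surj y : exists x, d x = y.
  apply: contrapT => /forallNP no_x.
  have hit x : exists z, x <> z /\ c x z = y.
    have [z xz_y] := listed_inj_surj mem_s (star_inj x) y.
    have [xz|/eqP xz] := eqVneq x z; last by exists z; rewrite -starE.
    by case: (no_x x); rewrite -xz_y -xz stard.
  have [k kP] := choice hit.
  have [|x] := @listed_inj_surj _ _ mem_s (fun x => c (k x) x) _ y.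
    move=> x x' eq_c; have [xk cx] := kP x; have [xk' cx'] := kP x'.
    by apply: c_inj2 eq_c => //; rewrite cx cx'.
  by have [xk cx] := kP x; rewrite -cx => /esym/c_neq; apply.
have d_inj := listed_surj_inj mem_s d_surj.
have star_neq x z : x <> z -> star x z <> star z x.
  by move=> xz; rewrite !starE //; [apply: c_neq | move/esym].
have star_inj2 x z x' z' : star x z = star x' z' -> star z x = star z' x' -> x = x'.
  have [<-|/eqP xz] := eqVneq x z; have [<-|/eqP xz'] := eqVneq x' z'.
  - by rewrite !stard => /d_inj.
  - by move=> -> /star_neq; case.
  - by move=> <- /esym/star_neq; case.
  - by rewrite !starE => //; [apply: c_inj2|move/esym|move/esym].
exists star => //; split=> //.
have gen x y z : x <> y -> z <> x -> z <> y ->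
    star (star x y) (star x z) = star (star y x) (star y z).
  move=> xy zx zy.
  have yx : y <> x by move/esym.
  have xz : x <> z by move/esym.
  have yz : y <> z by move/esym.
  rewrite (starE _ _ xy) (starE _ _ xz) (starE _ _ yx) (starE _ _ yz).
  rewrite !starE; first exact: c_cycle.
  - by move/c_inj => xz_eq; apply/xz/xz_eq.
  - by move/c_inj => yz_eq; apply/yz/yz_eq.
(* Both sides of the cycle identity are bijections of z that agree off {x, y},
   and the left value at y cannot be the right value at x. *)
have cyc x y : x <> y -> star (star x y) (star x x) = star (star y x) (star y x).
  move=> xy; have [z zE] := listed_inj_surj mem_s
    (inj_comp (star_inj (star x y)) (star_inj x)) (star (star y x) (star y x)).
  have [zx|/eqP zx] := eqVneq z x; first by move: zE; rewrite zx.
  have [zy|/eqP zy] := eqVneq z y.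
    by move: zE; rewrite /= zy !stard => /d_inj/star_neq; case.
  by move: zE; rewrite /= gen // => /star_inj/star_inj.
move=> x y z; have [->//|/eqP xy] := eqVneq x y.
have [->|/eqP zx] := eqVneq z x; first exact: cyc.
have [->|/eqP zy] := eqVneq z y; last exact: gen.
by rewrite -cyc //; move/esym.
Qed.

End Complement.

Section CycleSet.
Context {T : eqType} (s : seq T).
Hypothesis mem_s : forall x, x \in s.
Variable star : T -> T -> T.
Hypothesis star_inj : forall x, injective (star x).
Hypothesis star_inj2 : forall x z x' z',
  star x z = star x' z' -> star z x = star z' x' -> x = x'.
Hypothesis star_cycle :
  forall x y z, star (star x y) (star x z) = star (star y x) (star y z).

(* Every triple is of the form (x, x * y, (x * y) * (x * z)); on these the two
   maps permute (x, y, z) by transpositions. *)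
Lemma braid_of_transpositions (F G : T * T * T -> T * T * T) :
  (forall x y z, F (x, star x y, star (star x y) (star x z)) =
    (y, star y x, star (star y x) (star y z))) ->
  (forall x y z, G (x, star x y, star (star x y) (star x z)) =
    (x, star x z, star (star x z) (star x y))) ->
  F \o G \o F =1 G \o F \o G.
Proof.
move=> FE GE [[x y'] z'].
have [y <-] := listed_inj_surj mem_s (@star_inj x) y'.
have [z <-] := listed_inj_surj mem_s
  (inj_comp (@star_inj (star x y)) (@star_inj x)) z'.
by rewrite /= (FE x y z) (GE y x z) (FE y z x) (GE x y z) (FE x z y) (GE z x y).
Qed.

(** The passage from a cycle set to a solution: [g x] is the inverse of [star x], so every pair has
    the form [(x, star x z)]. Injectivity of each [f x] amounts to [star_inj2], and braiding to the
    cycle identity. *)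
Lemma cycle_set_solution : exists2 S : T * T -> T * T,
  nondegenerate_symmetric_solution S &
  forall x z, S (x, star x z) = (z, star z x).
Proof.
pose ld x := projT1 (choice (listed_inj_surj mem_s (@star_inj x))).
have ldK x y : star x (ld x y) = y by rewrite /ld; case: choice.
have starK x : cancel (star x) (ld x) by move=> y; apply: (@star_inj x).
pose S p := (ld p.1 p.2, star (ld p.1 p.2) p.1).
have SE x z : S (x, star x z) = (z, star z x) by rewrite /S /= starK.
have gE x : sol_g S x = ld x by [].
have fE x y : sol_f S y x = star (ld x y) x by [].
clearbody S.
have S12E x y z : S12 S (x, star x y, star (star x y) (star x z)) =
    (y, star y x, star (star y x) (star y z)).
  by rewrite /S12 SE star_cycle.
have S23E x y z : S23 S (x, star x y, star (star x y) (star x z)) =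
    (x, star x z, star (star x z) (star x y)).
  by rewrite /S23 SE.
exists S => //.
have invo : involutive S by move=> [x y]; rewrite -(ldK x y) !SE.
split; first exact: inv_bij.
- move=> x; split; last by rewrite gE; exists (star x).
  apply: (listed_inj_bij mem_s) => a b; rewrite !fE.
  move=> eq_f; apply: (star_inj2 (z := ld a x) (z' := ld b x)) eq_f.
  by rewrite !ldK.
- by split=> //; exact: braid_of_transpositions.
Qed.

End CycleSet.

(** * Atoms of a Garside submonoid *)

Section GarsideAtoms.
Context {G : groupType} (M : set G).
Hypothesis M1 : M 1.
Hypothesis MM : forall a b, M a -> M b -> M (a * b).
Hypothesis M_unit_free : forall a b, M a -> M b -> a * b = 1 -> a = 1.
Hypothesis M_disjoint_lcm : forall x z z' m, M x -> M z -> M z' ->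
  is_gcd (ldiv M) x z' 1 -> is_gcd (ldiv M) z z' 1 ->
  is_lcm (ldiv M) x z m -> ldiv M z' m -> z' = 1.

Lemma ldiv_refl a : M a -> ldiv M a a.
Proof. by move=> Ma; split=> //; exists 1; rewrite ?mulg1. Qed.

Lemma rdiv_refl a : M a -> rdiv M a a.
Proof. by move=> Ma; split=> //; exists 1; rewrite ?mul1g. Qed.

Lemma ldiv_mul a b : M a -> M b -> ldiv M a (a * b).
Proof. by move=> Ma Mb; split=> //; exists b. Qed.

Lemma rdiv_mul a b : M a -> M b -> rdiv M b (a * b).
Proof. by move=> Ma Mb; split=> //; exists a. Qed.

Lemma ldiv_trans a b d : ldiv M a b -> ldiv M b d -> ldiv M a d.
Proof.
move=> [Ma [s Ms ->]] [_ [t Mt ->]]; split=> //.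
by exists (s * t); [apply: MM | rewrite mulgA].
Qed.

Lemma ldiv_mul2l a b d : M a -> ldiv M b d -> ldiv M (a * b) (a * d).
Proof.
move=> Ma [Mb [s Ms ->]]; split; first exact: MM.
by exists s; rewrite // mulgA.
Qed.

Lemma ldiv_cancel a b d : M b -> ldiv M (a * b) (a * d) -> ldiv M b d.
Proof.
move=> Mb [_ [s Ms]]; rewrite -mulgA => /mulgI ->.
by split=> //; exists s.
Qed.

Lemma ldiv_antisym a b : ldiv M a b -> ldiv M b a -> a = b.
Proof.
move=> [Ma [s Ms ->]] [_ [t Mt]]; rewrite -{1}[a]mulg1 -mulgA => /mulgI st1.
by rewrite (M_unit_free Ms Mt) ?mulg1.
Qed.

Lemma rdiv_antisym a b : rdiv M a b -> rdiv M b a -> a = b.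
Proof.
move=> [Ma [s Ms ->]] [_ [t Mt]]; rewrite -{1}[a]mul1g mulgA => /mulIg ts1.
have t1 := M_unit_free Mt Ms (esym ts1).
by move: ts1; rewrite t1 mul1g => <-; rewrite mul1g.
Qed.

Lemma is_lcm_sym dv (x y m : G) : is_lcm dv x y m -> is_lcm dv y x m.
Proof. by move=> [xm ym mP]; split=> // z yz xz; apply: mP. Qed.

Lemma is_lcm_ldiv_unique x y m m' :
  is_lcm (ldiv M) x y m -> is_lcm (ldiv M) x y m' -> m = m'.
Proof.
by move=> [xm ym mP] [xm' ym' mP']; apply: ldiv_antisym; [apply: mP|apply: mP'].
Qed.

Lemma is_lcm_rdiv_unique x y m m' :
  is_lcm (rdiv M) x y m -> is_lcm (rdiv M) x y m' -> m = m'.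
Proof.
by move=> [xm ym mP] [xm' ym' mP']; apply: rdiv_antisym; [apply: mP|apply: mP'].
Qed.

Variables (Delta : G) (D : set G).
Hypothesis D_gen : garside_generating M Delta D.
Local Notation N := (submonoid_generated D).
Hypothesis N_closed : closed_under_right_complement M (atoms N).
Local Notation A := (atoms N).

Lemma gg_sub x : D x -> M x.
Proof. by case/(gg_simple D_gen). Qed.

Lemma gg_submonoid_sub x : N x -> M x.
Proof. exact: submonoid_generated_ind MM gg_sub x. Qed.

Lemma gg_gen x : D x -> N x.
Proof. by move=> Dx B [_]; apply. Qed.

(** An element of [N] other than 1 has a nontrivial first factor in [D]; for an atom the remaining
    factor is trivial. *)
Lemma atom_gg x : A x -> D x.
Proof.
have first_factor n : N n -> n = 1 \/ exists d m, [/\ D d, d <> 1, N m & n = d * m].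
  move: n; apply: submonoid_generated_ind; first by left.
    move=> a b [-> Pb|[d [m [Dd d1 Nm ->]]] Pb]; first by rewrite mul1g.
    right; exists d, (m * b); split=> //; last by rewrite mulgA.
    apply: submonoid_generatedM => //; case: Pb => [->|].
      exact: submonoid_generated1.
    by move=> [e [k [De _ Nk ->]]]; apply: submonoid_generatedM => //; apply: gg_gen.
  move=> a Da; have [->|/eqP a1] := eqVneq a 1; first by left.
  by right; exists a, 1; split=> //; [apply: submonoid_generated1|rewrite mulg1].
move=> [Nx x1 x_atom]; have [//|[d [m [Dd d1 Nm xE]]]] := first_factor x Nx.
by case: (x_atom d m (gg_gen Dd) Nm xE) => // m1; rewrite xE m1 mulg1.
Qed.

Lemma atom_sub x : A x -> M x.
Proof. by move/atom_gg/gg_sub. Qed.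

(* Left divisors in M need not have their cofactor in N: closure of D under
   right complements supplies it. *)
Lemma atom_ldiv a d : A a -> D d -> ldiv M d a -> d = 1 \/ d = a.
Proof.
move=> Aa Dd da; have [_ [r Mr aE]] := da.
have Dr : D r.
  apply: (gg_rcomplement D_gen Dd (atom_gg Aa)); split=> //; rewrite -aE.
  by split=> //; apply: ldiv_refl; apply: atom_sub.
case: Aa => Na _ a_atom; case: (a_atom d r (gg_gen Dd) (gg_gen Dr) aE); first by left.
by move=> r1; right; rewrite aE r1 mulg1.
Qed.

Lemma atom_rdiv a d : A a -> D d -> rdiv M d a -> d = 1 \/ d = a.
Proof.
move=> Aa Dd da; have [_ [r Mr aE]] := da.
have Dr : D r.
  apply: (gg_lcomplement D_gen Dd (atom_gg Aa)); split=> //; rewrite -aE.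
  by split=> //; apply: rdiv_refl; apply: atom_sub.
case: Aa => Na _ a_atom; case: (a_atom r d (gg_gen Dr) (gg_gen Dd) aE); last by left.
by move=> r1; right; rewrite aE r1 mul1g.
Qed.

(** The gcd lies in [D], so by [atom_ldiv] it is 1 or equal to both atoms. *)
Lemma atom_gcd x z : A x -> A z -> x <> z -> is_gcd (ldiv M) x z 1.
Proof.
move=> Ax Az xz; have [_ [d dP Dd]] := gg_lsublattice D_gen (atom_gg Ax) (atom_gg Az).
have [dx dz _] := dP.
have [<-//|dxE] := atom_ldiv Ax Dd dx.
have [<-//|dzE] := atom_ldiv Az Dd dz.
by case: xz; rewrite -dxE.
Qed.

Lemma atom_lcm x z : A x -> A z -> x <> z ->
  exists2 u, A u & is_lcm (ldiv M) x z (x * u).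
Proof.
move=> Ax Az xz; have [[m mP _] _] := gg_lsublattice D_gen (atom_gg Ax) (atom_gg Az).
have [[_ [y My mxy]] [_ [t Mt mzt]] _] := mP.
have [] := N_closed Ax Az xz My Mt; rewrite -?mxy // => Ay _.
by exists y => //; rewrite -mxy.
Qed.

(** Otherwise [z'] would lie below the lcm of [x] and [z] while being disjoint from both. *)
Lemma atom_lcm_inj x z z' u : A x -> A z -> A z' -> z <> x -> z' <> x ->
  is_lcm (ldiv M) x z (x * u) -> is_lcm (ldiv M) x z' (x * u) -> z = z'.
Proof.
move=> Ax Az Az' zx z'x lz [_ z'm _]; apply: contrapT => zz'.
case: (Az') => _ + _; apply; apply: M_disjoint_lcm lz z'm; try exact: atom_sub.
  by apply: atom_gcd => // /esym.
exact: atom_gcd.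
Qed.

(* The lcm of y and t for right divisibility is c y, where c right-divides the
   atom x. *)
Lemma atom_rdiv_lcm x y z t : A x -> A y -> A z -> A t -> x <> z ->
  x * y = z * t -> is_lcm (rdiv M) y t (x * y).
Proof.
move=> Ax Ay Az At xz xy_zt.
have [[m mP Dm] _] := gg_rsublattice D_gen (atom_gg Ay) (atom_gg At).
have [[_ [c Mc mE]] tm mmin] := mP.
have Dc : D c.
  apply: (gg_lcomplement D_gen (atom_gg Ay) (atom_gg At)).
  by split; rewrite // -mE.
have [||_ [w Mw]] := mmin (x * y).
- by apply: rdiv_mul; apply: atom_sub.
- by rewrite xy_zt; apply: rdiv_mul; apply: atom_sub.
rewrite mE mulgA => /mulIg xE.
have [c1|cx] := atom_rdiv Ax Dc (conj Mc (ex_intro2 _ _ w Mw xE)); last first.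
  by rewrite -cx -mE.
(* If [c] is trivial, [t] right-divides the atom [y], so [t = y], and cancelling gives [x = z]. *)
move: tm; rewrite mE c1 mul1g => /(atom_rdiv Ay (atom_gg At))[t1|ty].
  by case: At => _ /(_ t1).
by case: xz; move: xy_zt; rewrite ty => /mulIg.
Qed.

Lemma atom_val (x : A) : A (val x).
Proof. exact: set_mem (valP x). Qed.

Lemma atom_val_sub (x : A) : M (val x).
Proof. exact: atom_sub (atom_val x). Qed.

Hypothesis A_finite : exists s : seq A, forall x, x \in s.

Lemma atoms_star : exists2 star : A -> A -> A,
  forall x z, x <> z -> is_lcm (ldiv M) (val x) (val z) (val x * val (star x z)) &
  [/\ forall x, injective (star x),
   forall x z x' z', star x z = star x' z' -> star z x = star z' x' -> x = x' &
   forall x y z, star (star x y) (star x z) = star (star y x) (star y z)].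
Proof.
have c_ex (p : A * A) : exists u : A, p.1 <> p.2 ->
    is_lcm (ldiv M) (val p.1) (val p.2) (val p.1 * val u).
  (* On the diagonal [x] is only a placeholder; the facts about [c] below concern distinct
     arguments. *)
  case: p => x z /=; have [->|/eqP xz] := eqVneq x z; first by exists x.
  have [|u Au uP] := atom_lcm (atom_val x) (atom_val z); first by move/val_inj.
  by exists (exist _ u (mem_set Au)).
have [c' c'P] := choice c_ex; pose c x z := c' (x, z).
have cP x z : x <> z -> is_lcm (ldiv M) (val x) (val z) (val x * val (c x z)).
  exact: (c'P (x, z)).
have cC x z : x <> z -> val x * val (c x z) = val z * val (c z x).
  move=> xz; apply: is_lcm_ldiv_unique (cP _ _ xz) _.
  by apply/is_lcm_sym/cP => /esym.
have c_inj x z z' : z <> x -> z' <> x -> c x z = c x z' -> z = z'.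
  move=> zx z'x eq_c; apply/val_inj/(atom_lcm_inj (atom_val x)); try exact: atom_val.
  - by move/val_inj.
  - by move/val_inj.
  - by apply: cP => /esym.
  - by rewrite eq_c; apply: cP => /esym.
have c_neq x z : x <> z -> c x z <> c z x.
  by move=> xz eq_c; have := cC _ _ xz; rewrite eq_c => /mulIg/val_inj.
have c_inj2 x z x' z' : x <> z -> x' <> z' ->
    c x z = c x' z' -> c z x = c z' x' -> x = x'.
  move=> xz xz' eq_c eq_c'; apply: val_inj.
  have := cC _ _ xz; have := cC _ _ xz'; rewrite -eq_c -eq_c' => E' E.
  (* By [atom_rdiv_lcm] the common product is the lcm of the two complements for right divisibility,
     hence determined by them. *)
  apply: (@mulIg _ (val (c x z))).
  apply: is_lcm_rdiv_unique (atom_rdiv_lcm _ _ _ _ _ E) (atom_rdiv_lcm _ _ _ _ _ E');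
    try exact: atom_val.
  - by move/val_inj.
  - by move/val_inj.
(* The product is the lcm of [x], [y] and [z]: it divides every common multiple, and by [c_mult] it
   is one. *)
have c_min x y z m : x <> y -> x <> z -> y <> z ->
    ldiv M (val x) m -> ldiv M (val y) m -> ldiv M (val z) m ->
    ldiv M (val x * (val (c x y) * val (c (c x y) (c x z)))) m.
  move=> xy xz yz xm ym zm.
  have [_ _ xy_min] := cP _ _ xy; have [_ _ xz_min] := cP _ _ xz.
  have xym := xy_min _ xm ym; have xzm := xz_min _ xm zm.
  have [_ [m' Mm' mE]] := xm.
  rewrite mE in xym xzm *; apply: ldiv_mul2l; first exact: atom_val_sub.
  have ne_c : c x y <> c x z by move/c_inj => yz'; apply/yz/yz'; move/esym.
  have [_ _] := cP _ _ ne_c; apply.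
  - exact: ldiv_cancel (atom_val_sub _) xym.
  - exact: ldiv_cancel (atom_val_sub _) xzm.
have c_mult x y z : x <> y -> x <> z -> y <> z ->
    let m := val x * (val (c x y) * val (c (c x y) (c x z))) in
    [/\ ldiv M (val x) m, ldiv M (val y) m & ldiv M (val z) m].
  move=> xy xz yz; split.
  - by apply: ldiv_mul; [|apply: MM]; apply: atom_val_sub.
  - by rewrite mulgA cC // -mulgA; apply: ldiv_mul; [|apply: MM]; apply: atom_val_sub.
  - have ne_c : c x y <> c x z by move/c_inj => yz'; apply/yz/yz'; move/esym.
    rewrite cC // mulgA cC // -mulgA.
    by apply: ldiv_mul; [|apply: MM]; apply: atom_val_sub.
have [s mem_s] := A_finite.
have [|star starE [? ? ?]] := complement_extend mem_s c_inj c_neq c_inj2.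
  move=> x y z xy xz yz; have yx : y <> x by move/esym.
  have [xm ym zm] := c_mult _ _ _ xy xz yz; have [ym' xm' zm'] := c_mult _ _ _ yx yz xz.
  (* The triple lcm is symmetric in [x] and [y]; the factor [x (x \ y) = y (y \ x)] common to its
     two expressions cancels. *)
  apply/val_inj/(@mulgI _ (val (c x y)))/(@mulgI _ (val x)).
  apply: (etrans (ldiv_antisym (c_min _ _ _ _ xy xz yz xm' ym' zm')
                               (c_min _ _ _ _ yx yz xz ym xm zm))).
  by rewrite mulgA -cC // -mulgA.
by exists star => // x z xz; rewrite starE //; apply: cP.
Qed.

Lemma lcm_star_mul (star : A -> A -> A) :
  (forall x z : A, x <> z ->
    is_lcm (ldiv M) (val x) (val z) (val x * val (star x z))) ->
  forall x z : A, val x * val (star x z) = val z * val (star z x).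
Proof.
move=> star_lcm x z; have [->//|/eqP xz] := eqVneq x z.
by apply: is_lcm_ldiv_unique (star_lcm _ _ xz) _; apply/is_lcm_sym/star_lcm => /esym.
Qed.

(** When [x] and [g_x(y)] differ, [x y] is a common multiple of both, so their complement
    left-divides the atom [y] and equals it. Bijectivity of [g_x] and injectivity of [star x] settle
    the diagonal and the rest. *)
Lemma solution_star_unique (star : A -> A -> A) (S : A * A -> A * A) :
  (forall x, injective (star x)) ->
  (forall x z : A, x <> z ->
    is_lcm (ldiv M) (val x) (val z) (val x * val (star x z))) ->
  (forall x, bijective (sol_g S x)) ->
  (forall x y : A, val x * val y = val (sol_g S x y) * val (sol_f S y x)) ->
  forall x z, S (x, star x z) = (z, star z x).
Proof.
move=> star_inj star_lcm g_bij S_mul.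
have non_fixed x y : x <> sol_g S x y -> star x (sol_g S x y) = y.
  move=> xg; have [_ _ lcm_min] := star_lcm _ _ xg.
  have := lcm_min (val x * val y); case.
  - by apply: ldiv_mul; apply: atom_val_sub.
  - by rewrite S_mul; apply: ldiv_mul; apply: atom_val_sub.
  move=> _ [t Mt]; rewrite -mulgA => /mulgI yE.
  have /(atom_ldiv (atom_val y) (atom_gg (atom_val _)))[] :
    ldiv M (val (star x (sol_g S x y))) (val y).
    by split; [apply: atom_val_sub | exists t].
  - by case: (atom_val (star x (sol_g S x y))) => _ + _ star1; case.
  - exact: val_inj.
have gE x z : sol_g S x (star x z) = z.
  have [<-|/eqP xz] := eqVneq x z.
    (* Otherwise [non_fixed] would make [star x] take the value [star x x] at a second point. *)
    apply: contrapT => gx; apply/gx/(star_inj x)/non_fixed => xg.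
    exact: gx (esym xg).
  have [g' _ gK] := g_bij x.
  by have := @non_fixed x (g' z); rewrite gK => /(_ xz) ->.
have star_mul := lcm_star_mul star_lcm.
move=> x z; rewrite [LHS]surjective_pairing.
rewrite -/(sol_g S x (star x z)) -/(sol_f S (star x z) x).
congr (_, _); first exact: gE.
apply/val_inj/(@mulgI _ (val z)).
by rewrite -[RHS]star_mul [RHS]S_mul gE.
Qed.

Variable len : G -> nat.
Hypothesis lenM : forall a b, M a -> M b -> len (a * b) = (len a + len b)%N.
Hypothesis len_eq0 : forall a, M a -> len a = 0 -> a = 1.

(** Length is additive and positive away from 1, so both factors of a proper factorization are
    shorter. *)
Lemma atoms_generate n : N n -> exists w : seq A, n = \prod_(x <- w) val x.
Proof.
have [k] := ubnP (len n); elim: k n => // k IHk n le_n Nn.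
have [->|/eqP n1] := eqVneq n 1; first by exists [::]; rewrite big_nil.
have [An|not_atom] := pselect (A n).
  by exists [:: exist _ n (mem_set An)]; rewrite big_seq1.
have [y [z [Ny Nz nE y1 z1]]] : exists y z, [/\ N y, N z, n = y * z, y <> 1 & z <> 1].
  apply: contrapT => no_split; apply: not_atom; split=> // y z Ny Nz nE.
  have [->|/eqP y1] := eqVneq y 1; first by left.
  have [->|/eqP z1] := eqVneq z 1; first by right.
  by case: no_split; exists y, z.
have My := gg_submonoid_sub Ny; have Mz := gg_submonoid_sub Nz.
have len_gt0 a : M a -> a <> 1 -> (0 < len a)%N.
  by move=> Ma a1; rewrite lt0n; apply/eqP => /(len_eq0 Ma).
have := len_gt0 _ My y1; have := len_gt0 _ Mz z1.
move: le_n; rewrite nE lenM // => le_n z0 y0.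
have [||u ->] := IHk y => //.
  by apply: leq_trans (le_n : _ <= k); rewrite -addn1 leq_add2l.
have [||v ->] := IHk z => //.
  by apply: leq_trans (le_n : _ <= k); rewrite -addn1 addnC leq_add2r.
by exists (u ++ v); rewrite big_cat.
Qed.

End GarsideAtoms.

(** * Embedding of the structure group of the atoms *)

Section GroupMorphism.
Context {G H : groupType} (f : {multiplicative G -> H}).

Lemma multiplicative1 : f 1 = 1.
Proof. by apply: (@mulgI _ (f 1)); rewrite -gmulfM !mulg1. Qed.

Let F : UMagmaMorphism.type G H :=
  HB.pack (Multiplicative.sort f) (isMultiplicative.Build G H f (@gmulfM _ _ f))
    (Multiplicative_isUMagmaMorphism.Build G H f multiplicative1).

Lemma multiplicativeV a : f a^-1 = (f a)^-1.
Proof. exact: (gmulfV F). Qed.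

Lemma multiplicative_inj : (forall a, f a = 1 -> a = 1) -> injective f.
Proof. exact: (@gmulf_inj _ _ F). Qed.

End GroupMorphism.

Section Faithful.
Context {G : groupType} (M : set G).
Hypothesis M1 : M 1.
Hypothesis MM : forall a b, M a -> M b -> M (a * b).
Hypothesis M_unit_free : forall a b, M a -> M b -> a * b = 1 -> a = 1.
Context {X : choiceType} (S : X * X -> X * X) (star : X -> X -> X).
Hypothesis S_star : forall x z, S (x, star x z) = (z, star z x).
Variable phi : {multiplicative structure_group S -> G}.
Hypothesis phi_gen_M : forall x, M (phi (sg_gen S x)).
Hypothesis phi_gen_neq1 : forall x, phi (sg_gen S x) <> 1.
Hypothesis star_lcm : forall x z, x <> z ->
  is_lcm (ldiv M) (phi (sg_gen S x)) (phi (sg_gen S z))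
    (phi (sg_gen S x) * phi (sg_gen S (star x z))).

Lemma sg_gen_star x z :
  sg_gen S x * sg_gen S (star x z) = sg_gen S z * sg_gen S (star z x).
Proof. by rewrite sg_gen_sol /sol_g /sol_f S_star. Qed.

Lemma phi_pos_sub w : M (phi (pos_class S w)).
Proof.
elim: w => [|x w IHw]; first by rewrite pos_class_nil multiplicative1.
by rewrite pos_class_cons gmulfM; apply: MM.
Qed.

(* Completing the words u and z to a common multiple by word reversing gives,
   already in the structure group, an element whose image is the lcm. *)
Lemma word_reversing u z : exists v s,
  pos_class S (z :: v) = pos_class S (u ++ s) /\
  forall m, ldiv M (phi (pos_class S u)) m -> ldiv M (phi (sg_gen S z)) m ->
    ldiv M (phi (pos_class S (u ++ s))) m.
Proof.
elim: u z => [|x u IHu] z; first by exists [::], [:: z].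
have [->|/eqP xz] := eqVneq x z.
  by exists u, [::]; rewrite cats0.
(* Past the letter [x], the letter [z] becomes [star x z], while [star z x] is put out on the other
   side. *)
have [v [s [vs_E vs_min]]] := IHu (star x z).
exists (star z x :: v), s; split.
  by rewrite cat_cons !pos_class_cons mulgA -sg_gen_star -mulgA -vs_E pos_class_cons.
move=> m; rewrite cat_cons !pos_class_cons !gmulfM => xum zm.
have xm : ldiv M (phi (sg_gen S x)) m.
  by apply: ldiv_trans xum => //; apply: ldiv_mul => //; apply: phi_pos_sub.
have [_ _ xz_min] := star_lcm xz; have := xz_min _ xm zm.
have [_ [m' Mm' mE]] := xm; rewrite mE in xum *.
move=> xzm; apply: ldiv_mul2l => //; apply: vs_min; apply: ldiv_cancel; eauto.
  exact: phi_pos_sub.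
Qed.

Lemma phi_pos_eq1 u : phi (pos_class S u) = 1 -> u = [::].
Proof.
case: u => // x u; rewrite pos_class_cons gmulfM => /M_unit_free x1.
by case: (@phi_gen_neq1 x); apply: x1 => //; apply: phi_pos_sub.
Qed.

(** Reverse [v] against the first letter [z] of the other word. The image of [v] is already a common
    multiple, so nothing is appended to [v]; hence [v] can be rewritten to start with [z], which
    cancels. *)
Lemma phi_pos_inj u v : phi (pos_class S u) = phi (pos_class S v) ->
  pos_class S u = pos_class S v.
Proof.
elim: u v => [|z u IHu] v.
  by rewrite pos_class_nil multiplicative1 => /esym/phi_pos_eq1 ->.
move=> uv; have [w [s [wE ws_min]]] := word_reversing v z.
have := ws_min (phi (pos_class S v)); case.
- by apply: ldiv_refl => //; apply: phi_pos_sub.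
- by rewrite -uv pos_class_cons gmulfM; apply: ldiv_mul => //; apply: phi_pos_sub.
move=> _ [t Mt]; rewrite pos_class_cat gmulfM -mulgA -{1}[phi _]mulg1 => /mulgI st1.
have s0 : s = [::].
  by apply: phi_pos_eq1; apply: M_unit_free (esym st1) => //; apply: phi_pos_sub.
have vE : pos_class S v = pos_class S (z :: w) by rewrite wE s0 cats0.
rewrite vE !pos_class_cons; congr (_ * _).
apply: IHu; apply: (@mulgI _ (phi (sg_gen S z))).
by rewrite -!gmulfM -!pos_class_cons uv vE.
Qed.

(** Word reversing gives the Ore condition: it moves an inverse letter to the right of a positive
    word. *)
Lemma structure_group_fraction a :
  exists u v, a = pos_class S u * (pos_class S v)^-1.
Proof.
move: a; apply: structure_group_ind => [|x _ [u [v ->]]|x _ [u [v ->]]].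
- by exists [::], [::]; rewrite mulgV.
- by exists (x :: u), v; rewrite pos_class_cons mulgA.
have [w [s [wE _]]] := word_reversing u x.
exists w, (v ++ s); rewrite pos_class_cat invgM !mulgA; congr (_ * _).
apply: (@mulgI _ (sg_gen S x)).
by rewrite !mulgA mulgV mul1g -pos_class_cons wE pos_class_cat mulgK.
Qed.

Lemma phi_injective : injective phi.
Proof.
apply: multiplicative_inj => a; have [u [v ->]] := structure_group_fraction a.
rewrite gmulfM multiplicativeV => /divg1_eq/phi_pos_inj ->; exact: mulgV.
Qed.

End Faithful.

(** * Assembly: the solution on the atoms, its uniqueness, and the image of its structure group *)

Theorem proposition5p3 (X : finType) (S : X * X -> X * X)
    (N H : set (structure_group S)) :
  nondegenerate_symmetric_solution S ->
  garside_subgroup S N H ->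
  closed_under_right_complement (structure_monoid S) (atoms N) ->
  exists! S_H : atoms N * atoms N -> atoms N * atoms N,
    nondegenerate_symmetric_solution S_H /\
    exists phi : {multiplicative structure_group S_H -> structure_group S},
      structure_group_iso S_H H phi.
Proof.
move=> S_sol [Delta [[MDelta _ _] _] [[D D_gen ->] ->]] {N H} N_closed.
set M := structure_monoid S in D_gen N_closed *.
set A := atoms _ in N_closed *.
have M1 : M 1 by apply: submonoid_generated1.
have MM a b : M a -> M b -> M (a * b) by apply: submonoid_generatedM.
have M_unit := @structure_monoid_unit_free _ _ S_sol.
have lenM := @pos_lengthM _ _ S_sol; have len0 := @pos_length_eq0 _ _ S_sol.
have disj := @disjoint_ldiv_lcm _ _ S_sol.
have A_finite : exists s : seq A, forall x, x \in s.
  (* Atoms lie in [D], hence among the finitely many left divisors of [Delta]. *)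
  have [s s_div] := structure_monoid_finite S_sol MDelta.
  exists (pmap insub s) => x; rewrite mem_pmap_sub; apply: s_div.
  by apply: (gg_simple D_gen); apply: atom_gg; apply: atom_val.
have [star star_lcm [star_inj star_inj2 star_cycle]] :=
  atoms_star M1 MM M_unit disj D_gen N_closed A_finite.
have [s mem_s] := A_finite.
have [S_H S_H_sol S_H_star] := cycle_set_solution mem_s star_inj star_inj2 star_cycle.
have unique_S_H S' : (forall x, bijective (sol_g S' x)) ->
    (forall x y : A, val x * val y = val (sol_g S' x y) * val (sol_f S' y x)) ->
    S_H = S'.
  move=> g_bij S'_mul; apply/funext => -[x y].
  have [z <-] := listed_inj_surj mem_s (star_inj x) y.
  by rewrite S_H_star (solution_star_unique M1 M_unit D_gen star_inj star_lcm).
exists S_H; split; last first.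
  (* As [phi] extends the inclusion, it carries the defining relations of [S'] to relations between
     atoms. *)
  move=> S' [[_ nd _] [phi [_ _ phiE]]]; apply: unique_S_H => [x|x y].
    by case: (nd x).
  by rewrite -!phiE -!gmulfM sg_gen_sol.
split=> //.
have star_mul := lcm_star_mul M_unit star_lcm.
have [|phi phiE] := @structure_group_lift _ S_H _ (fun x : A => val x).
  move=> x y; have [z <-] := listed_inj_surj mem_s (star_inj x) y.
  by rewrite /sol_g /sol_f S_H_star star_mul.
exists phi; split=> //.
  apply: (phi_injective M1 MM M_unit S_H_star).
  - by move=> x; rewrite phiE; apply: (atom_val_sub D_gen).
  - by move=> x; rewrite phiE; case: (set_mem (valP x)).
  - by move=> x z; rewrite !phiE; apply: star_lcm.
apply/seteqP; split.
  move=> _ [a _ <-] B [[B1 BF] NB]; rewrite in_setE in B1.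
  (* Closure is given for 1 and division; inverses and products are recovered from these. *)
  have BV b : B b -> B b^-1.
    move=> Bb; suff: 1 / b \in mem B by rewrite div1g in_setE.
    by apply: BF; rewrite in_setE.
  have BM b c : B b -> B c -> B (b * c).
    move=> Bb /BV Bc; suff: b / c^-1 \in mem B by rewrite invgK in_setE.
    by apply: BF; rewrite in_setE.
  have Bval x : B (phi (sg_gen S_H x)).
    by rewrite phiE; apply: NB; case: (set_mem (valP x)).
  move: a; apply: structure_group_ind => [|x a Ba|x a Ba].
  - by rewrite multiplicative1.
  - by rewrite gmulfM; apply: BM.
  - by rewrite gmulfM multiplicativeV; apply/BM/Ba/BV.
apply: smallest_sub.
  split; first by rewrite in_setE; exists 1; rewrite // multiplicative1.
  move=> a b; rewrite !in_setE => -[c _ <-] [d _ <-].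
  by exists (c / d); rewrite // gmulfM multiplicativeV.
move=> n /(atoms_generate M1 MM D_gen lenM len0)[w ->].
exists (pos_class S_H w) => //.
elim: w => [|x w IHw]; first by rewrite big_nil multiplicative1.
by rewrite pos_class_cons gmulfM phiE IHw big_cons.
Qed.
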